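(* Let $d\ge 3$ and let $F \leq \mathrm{Sym}(\{1,\dots,d\})$ be primitive but not cyclic of prime order. Then $U(F)^+$ has the Howe--Moore property if and only if for every unitary representation $(\pi,\mathcal{H})$ of $U(F)^+$ without non-zero $U(F)^+$-invariant vectors, and for every non-zero $v\in\mathcal{H}$, the closed isotropy subgroup $(U(F)^+)_v := \{g\in U(F)^+ \mid \pi(g)(v)=v\}$ is compact.
   Context: $T_d$ is the $d$-regular tree, $d\ge 3$, and $\mathrm{Aut}(T_d)$ is its automorphism group with the compact-open topology. A legal coloring of $T_d$ is a map $\iota$ from the set of unoriented edges of $T_d$ to $\{1,\dots,d\}$ whose restriction to the star $E(x)$ (the set of edges containing $x$) is a bijection onto $\{1,\dots,d\}$ for every vertex $x$. Fix such an $\iota$. For $F\le \mathrm{Sym}(\{1,\dots,d\})$, $U(F):=\{g\in \mathrm{Aut}(T_d) \mid \iota\circ g\circ(\iota|_{E(x)})^{-1}\in F \text{ for every vertex } x\}$, and $U(F)^+$ is the subgroup of $U(F)$ generated by those elements of $U(F)$ which fix some edge of $T_d$ pointwise. It is a closed subgroup of $\mathrm{Aut}(T_d)$, hence a locally compact group. ''Primitive'' refers to the action of $F$ on $\{1,\dots,d\}$. A unitary representation $(\pi,\mathcal{H})$ of a locally compact group $G$ is a strongly continuous homomorphism $\pi:G\to\mathcal{U}(\mathcal{H})$, with $\mathcal{H}$ an (infinite-dimensional) complex Hilbert space. Its matrix coefficients are the functions $c_{v,w}(g)=\langle\pi(g)v,w\rangle$, $v,w\in\mathcal{H}$; $c_{v,w}$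 vanishes at infinity if for every $\epsilon>0$ the set $\{g\in G \mid |c_{v,w}(g)|\ge\epsilon\}$ is compact. $G$ has the Howe--Moore property if for every unitary representation of $G$ without non-zero $G$-invariant vectors, all matrix coefficients vanish at infinity. *)

(* Defs.v *)
From HB Require Import structures.
From mathcomp Require Import all_boot all_order all_algebra.
From mathcomp Require Import all_fingroup all_solvable sesquilinear.
From mathcomp Require Import complex.
From mathcomp Require Import all_classical all_reals.
From mathcomp Require Import topology normedtype.

Set Implicit Arguments.
Unset Strict Implicit.
Unset Printing Implicit Defensive.

Import Order.TTheory GRing.Theory Num.Theory Num.Def.

Local Open Scope classical_set_scope.
Local Open Scope ring_scope.
Local Open Scope complex_scope.

HB.mixin Record Topological_Group_isTopologicalGroup G
    of Topological G & monoid.Group G := {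
  mulg_continuous : continuous (fun xy : G * G => (xy.1 * xy.2)%g) ;
  invg_continuous : continuous (fun x : G => (x^-1)%g)
}.

#[short(type="topologicalGroupType")]
HB.structure Definition TopologicalGroup :=
  {G of Topological G & monoid.Group G & Topological_Group_isTopologicalGroup G}.

Definition generated (G : groupType) (A : set G) : set G :=
  smallest [set K : set G | group_closed (mem K)] A.

Lemma generated_group_closed (G : groupType) (A : set G) :
  group_closed (mem (generated A)).
Proof.
split=> [|x y]; rewrite !inE.
  by move=> K [[K1 _] _]; move: K1; rewrite inE.
move=> Ax Ay K [[K1 KF] AK]; have := KF x y; rewrite !inE; apply.
- by apply: Ax.
- by apply: Ay.
Qed.

Definition generated_group (G : groupType) (A : set G) : Type :=
  set_type (generated A).

HB.instance Definition _ (G : groupType) (A : set G) :=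
  SubChoice.on (generated_group A).

HB.instance Definition _ (G : groupType) (A : set G) :=
  SubChoice_isSubGroup.Build G (mem (generated A)) (generated_group A)
    (generated_group_closed A).

HB.instance Definition _ (G : topologicalGroupType) (A : set G) :=
  Topological.copy (generated_group A) (set_type (generated A)).

Section GeneratedTopologicalGroup.
Variables (G : topologicalGroupType) (A : set G).
Let K := generated_group A.

Lemma generated_mul_continuous :
  continuous (fun xy : K * K => (xy.1 * xy.2)%g).
Proof.
apply/continuousP => B [C oC <-].
have valc : continuous (val : K -> G).
  exact: (@initial_continuous K G val).
rewrite -comp_preimage.
have -> : val \o (fun xy : K * K => (xy.1 * xy.2)%g) =
          (fun xy => val xy.1 * val xy.2)%g by apply/funext=> -[x y].
move: C oC; apply/continuousP => xy.
apply: (@continuous_comp _ _ _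
  (fun xy : K * K => (val xy.1, val xy.2)) (fun uv => uv.1 * uv.2)%g).
  apply: (@cvg_pair _ _ _ _ _ _ _ _).
    apply: (@continuous_comp (K * K)%type K G fst val); first exact: cvg_fst.
    exact: valc.
  apply: (@continuous_comp (K * K)%type K G snd val); first exact: cvg_snd.
  exact: valc.
exact: mulg_continuous.
Qed.

Lemma generated_inv_continuous : continuous (fun x : K => (x^-1)%g).
Proof.
apply/continuousP => B [C oC <-].
have valc : continuous (val : K -> G).
  exact: (@initial_continuous K G val).
rewrite -comp_preimage.
have -> : val \o (fun x : K => (x^-1)%g) = (fun x => (val x)^-1)%g.
  by apply/funext=> x.
move: C oC; apply/continuousP => x.
by apply: (@continuous_comp K G G val _ x (valc x)); exact: invg_continuous.
Qed.

HB.instance Definition _ :=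
  Topological_Group_isTopologicalGroup.Build (generated_group A)
    generated_mul_continuous generated_inv_continuous.

End GeneratedTopologicalGroup.

HB.mixin Record isHilbert (R : realType) H of CompleteNormedModule R[i] H := {
  inner : {dot H for (@conjC R[i])} ;
  inner_norm : forall v : H, inner v v = `|v| ^+ 2
}.

#[short(type="hilbertType")]
HB.structure Definition Hilbert (R : realType) :=
  {H of isHilbert R H & CompleteNormedModule R[i] H}.

(* arbitrarily large finite linearly independent families *)
Definition infinite_dimensional (R : realType) (H : hilbertType R) : Prop :=
  forall n : nat, exists e : 'I_n -> H, forall a : 'I_n -> R[i],
    \sum_i a i *: e i = 0 -> forall i, a i = 0.

Definition unitary_operator (R : realType) (H : hilbertType R)
    (u : {linear H -> H}) : Prop :=
  bijective u /\ forall v w : H, inner (u v) (u w) = inner v w.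

(* Each operator is bijective, so multiplicativity forces [rep_fun 1] to be the
   identity. *)
Record unitary_rep (R : realType) (G : topologicalGroupType)
    (H : hilbertType R) := UnitaryRep {
  rep_fun :> G -> {linear H -> H} ;
  rep_unitary : forall g, unitary_operator (rep_fun g) ;
  rep_mul : forall g h v, rep_fun (g * h)%g v = rep_fun g (rep_fun h v) ;
  rep_strongly_continuous : forall v, continuous (fun g => rep_fun g v)
}.

Section Representations.
Variables (R : realType) (G : topologicalGroupType) (H : hilbertType R).
Variable pi : unitary_rep G H.

Definition no_invariant_vectors : Prop :=
  forall v : H, (forall g, pi g v = v) -> v = 0.

Definition matrix_coef (v w : H) (g : G) : R[i] := inner (pi g v) w.

Definition isotropy (v : H) : set G := [set g | pi g v = v].

End Representations.

Definition vanishes_at_infinity (R : realType) (G : topologicalType)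
    (c : G -> R[i]) : Prop :=
  forall eps : R, 0 < eps -> compact [set g | eps%:C <= `|c g|].

(* Restricting to infinite-dimensional spaces loses no generality: replace a
   representation by a countably infinite multiple of it. *)
Definition Howe_Moore (R : realType) (G : topologicalGroupType) : Prop :=
  forall (H : hilbertType R) (pi : unitary_rep G H),
    infinite_dimensional H -> no_invariant_vectors pi ->
    forall v w : H, vanishes_at_infinity (matrix_coef pi v w).

Section Trees.
Variables (V : choiceType) (adj : rel V).
Local Notation D := (discrete_topology V).

Record tree : Prop := Tree {
  tree_nonempty : inhabited V ;
  tree_sym : symmetric adj ;
  tree_irrefl : irreflexive adj ;
  tree_connected : forall x y, exists2 p, path adj x p & last x p = y ;
  (* a cyclic sequence of distinct vertices of size 2 is a mere edge *)
  tree_acyclic : forall c, ucycle adj c -> (size c <= 2)%N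
}.

Definition regular_tree (d : nat) : Prop :=
  tree /\ forall x, ([set y | adj x y] #= `I_d)%card.

Definition edges : set (set V) :=
  [set E | exists x y, adj x y /\ E = [set x; y]].

Definition star (x : V) : set (set V) := [set E | edges E /\ E x].

Definition automorphism (g : V -> V) : Prop :=
  bijective g /\ forall x y, adj (g x) (g y) = adj x y.

(* An automorphism acts on the discrete set of vertices; the compact-open
   topology on maps of vertices is the topology of pointwise convergence. *)
Definition automorphisms :
    set {compact-open, D -> D} :=
  [set g | automorphism g].

Definition tree_aut : Type := set_type automorphisms.

HB.instance Definition _ := SubChoice.on tree_aut.
HB.instance Definition _ := Topological.copy tree_aut (set_type automorphisms).

Definition aut_fun (g : tree_aut) : V -> V := val g.
Coercion aut_fun : tree_aut >-> Funclass.

Lemma aut_funP (g : tree_aut) : automorphism g.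
Proof. by have := valP g; rewrite inE. Qed.

Lemma aut_ext (g h : tree_aut) : (forall x, g x = h x) -> g = h.
Proof. by move=> gh; apply: val_inj; apply/funext. Qed.

Lemma automorphism_id : automorphism idfun.
Proof. by split=> //; exists idfun. Qed.

Lemma automorphism_comp g h :
  automorphism g -> automorphism h -> automorphism (g \o h).
Proof.
move=> [bg ag] [bh ah]; split; first exact: bij_comp.
by move=> x y; rewrite /= ag ah.
Qed.

Definition inv_fun (g : tree_aut) : V -> V :=
  projT1 (cid (let: Bijective h hK Kh := (aut_funP g).1 in
    ex_intro (fun k => cancel g k /\ cancel k g) h (conj hK Kh))).

Lemma inv_funK (g : tree_aut) : cancel g (inv_fun g) /\ cancel (inv_fun g) g.
Proof. by rewrite /inv_fun; case: cid. Qed.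

Lemma automorphism_inv (g : tree_aut) : automorphism (inv_fun g).
Proof.
have [gK Kg] := inv_funK g; split; first by exists g.
by move=> x y; rewrite -(aut_funP g).2 !Kg.
Qed.

Definition mk_aut (g : V -> V) (ag : automorphism g) : tree_aut :=
  @exist {compact-open, D -> D} (fun h => h \in automorphisms) g (mem_set ag).

Definition aut_one := mk_aut automorphism_id.
Definition aut_mul (g h : tree_aut) :=
  mk_aut (automorphism_comp (aut_funP g) (aut_funP h)).
Definition aut_inv (g : tree_aut) := mk_aut (automorphism_inv g).

Lemma aut_mulA : associative aut_mul.
Proof. by move=> g h k; apply: aut_ext. Qed.
Lemma aut_mul1 : left_id aut_one aut_mul.
Proof. by move=> g; apply: aut_ext. Qed.
Lemma aut_mulr1 : right_id aut_one aut_mul.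
Proof. by move=> g; apply: aut_ext. Qed.
Lemma aut_mulV : left_inverse aut_one aut_inv aut_mul.
Proof. by move=> g; apply: aut_ext => x; exact: (inv_funK g).1. Qed.
Lemma aut_mulrV : right_inverse aut_one aut_inv aut_mul.
Proof. by move=> g; apply: aut_ext => x; exact: (inv_funK g).2. Qed.

HB.instance Definition _ :=
  isGroup.Build tree_aut
    aut_mulA aut_mul1 aut_mulr1 aut_mulV aut_mulrV.

Lemma aut_mulE (g h : tree_aut) x : ((g * h)%g : tree_aut) x = g (h x).
Proof. by []. Qed.

Lemma aut_invK (g : tree_aut) : cancel g ((g^-1)%g : tree_aut).
Proof. exact: (inv_funK g).1. Qed.

Lemma aut_invVK (g : tree_aut) : cancel ((g^-1)%g : tree_aut) g.
Proof. exact: (inv_funK g).2. Qed.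

Lemma aut_cvgP (F : set_system tree_aut) (g : tree_aut) : Filter F ->
  F --> g <-> forall x, F [set h : tree_aut | h x = g x].
Proof.
move=> FF; split=> [Fg x|Fg].
  apply: Fg.
  exists (val @^-1` [set h : {compact-open, D -> D} |
                      h @` [set x] `<=` [set g x]]).
  split=> /=.
  - eexists; last reflexivity.
    apply: compact_open_open; first exact: compact_set1.
    exact: discrete_open.
  - by move=> _ [_ -> <-].
  - by move=> h /= hx; apply: hx; exists x.
move=> B [_ [[C oC <-] Cg CB]].
apply: filterS CB _.
have : (val : tree_aut -> {compact-open, D -> D}) @ F --> val g.
  apply/compact_open_cvgP => K O cK oO gKO.
  suff : \forall h \near F, K `<=` (fun x => O ((h : tree_aut) x)).
    by apply: filterS => h hO _ [x Kx <-]; exact: hO.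
  have cov := (@compact_near_coveringP D K).1 cK.
  apply: (cov _ F (fun (h : tree_aut) x => O (h x)) FF) => x Kx.
  exists ([set x], [set h : tree_aut | h x = g x]).
    by split; [exact: (@discrete_set1 D) | exact: Fg].
  by move=> [y h] /= [-> hx]; rewrite hx; apply: gKO; exists x.
by apply; apply: open_nbhs_nbhs.
Qed.

Lemma aut_nbhs (g : tree_aut) x : nbhs g [set h : tree_aut | h x = g x].
Proof. by have /aut_cvgP : nbhs g --> g by []; apply. Qed.

Lemma aut_mul_continuous :
  continuous (fun gh : tree_aut * tree_aut => (gh.1 * gh.2)%g).
Proof.
move=> [g h]; apply/aut_cvgP => x.
exists ([set k : tree_aut |
          k ((h : tree_aut) x) = (g : tree_aut) ((h : tree_aut) x)],
        [set k : tree_aut | k x = (h : tree_aut) x]).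
  by split; apply: aut_nbhs.
by move=> [k l] [/= kE lE]; rewrite /= !aut_mulE lE kE.
Qed.

Lemma aut_inv_continuous : continuous (fun g : tree_aut => (g^-1)%g).
Proof.
move=> g; have Fg : Filter ((fun g : tree_aut => (g^-1)%g) @ g).
  exact: fmap_filter (@nbhs_filter tree_aut g).
apply/(@aut_cvgP _ (g^-1)%g Fg) => x.
apply: filterS (aut_nbhs g (((g^-1)%g : tree_aut) x)) => k /= kE.
by rewrite -{1}[x](aut_invVK g) -kE aut_invK.
Qed.

HB.instance Definition _ :=
  Topological_Group_isTopologicalGroup.Build tree_aut
    aut_mul_continuous aut_inv_continuous.

End Trees.

Section UniversalGroup.
Variables (V : choiceType) (adj : rel V) (d : nat).

(* An unoriented edge is the set of its two endpoints; the values of a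
   coloring outside [edges adj] are never used. *)
Variable iota : set V -> 'I_d.

Definition legal_coloring : Prop :=
  forall x, set_bij (star adj x) [set: 'I_d] iota.

(* [iota \o g \o (iota|E(x))^-1], with E(x) = star x *)
Definition local_action (g : tree_aut adj) (x : V) : 'I_d -> 'I_d :=
  iota \o (fun E : set V => g @` E) \o 'pinv_(fun=> set0) (star adj x) iota.

Variable F : {set 'S_d}.

Definition universal_group : set (tree_aut adj) :=
  [set g | forall x, exists2 s, s \in F & local_action g x = s].

Definition fixes_edge (g : tree_aut adj) : Prop :=
  exists2 E, edges adj E & forall x, E x -> g x = x.

Definition universal_group_plus : topologicalGroupType :=
  generated_group [set g | universal_group g /\ fixes_edge g].

End UniversalGroup.

(* Main.v *)
Require Import Defs.
From HB Require Import structures.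
From mathcomp Require Import all_boot all_order all_algebra.
From mathcomp Require Import all_fingroup all_solvable sesquilinear.
From mathcomp Require Import complex.
From mathcomp Require Import all_classical all_reals.
From mathcomp Require Import topology normedtype.
From mathcomp Require Import ring lra zify.

Set Implicit Arguments.
Unset Strict Implicit.
Unset Printing Implicit Defensive.

Import Order.TTheory GRing.Theory Num.Theory Num.Def.

Local Open Scope classical_set_scope.
Local Open Scope ring_scope.
Local Open Scope complex_scope.

(** If all coefficients vanish at infinity, the isotropy group of [v <> 0] is
    compact because it is closed and the coefficient of [v] with itself is
    constant, equal to the squared norm of [v], on it.

    Conversely, suppose that a coefficient [inner (pi g v) w] does not vanish at
    infinity.  Then it stays away from zero along an ultrafilter on
    [U(F)^+] that has no limit.  Such an ultrafilter sends a base vertex [x0] to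
    an end of the tree: otherwise the image of [x0] would be constant along it,
    and it would converge, vertex stabilizers being compact
    ([ultra_fixed_cvg], [escaping_prefix]).

    Every [u] that fixes pointwise a half-tree containing that end satisfies
    [g^-1 u g --> 1] along the ultrafilter.  By the Mautner phenomenon some
    non-zero vector is fixed by all these [u] ([contracted_fixed_vector]).
    Instead of a weak limit of the vectors [pi g v], the vector of smallest norm
    is taken in the closed affine subspace of all [x] such that
    [inner (pi g v) (x - w)] tends to zero: that subspace contains [w], is
    preserved by these [u], and does not contain zero.

    It remains to see that these [u] do not lie in a compact set.  Let [c m] be
    the colors of the ray from [x0] to the end.  As [F] is primitive and not
    cyclic of prime order, some element of [F] fixes [c m.+1] and moves [c m]
    ([primitive_stab_moves]).  Letting it permute the colors on the side of
    [x0] of the edge of color [c m.+1], and nothing on the other side, gives an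
    element of [U(F)^+] that fixes a half-tree around the end and moves [x0] to
    distance [2 * m.+1] ([ray_twists]).  The isotropy group of the fixed vector
    therefore moves [x0] to infinitely many vertices, and is not compact. *)

(** * Norms and minimal vectors in Hilbert spaces *)

Section RealNorm.
Variables (R : realType) (U : normedZmodType R[i]).
Implicit Types x y : U.

(** Norms over the complex numbers take their values in the complex numbers;
    [nrm] is the same norm with values in the reals. *)
Definition nrm x : R := complex.Re `|x|.

Lemma nrmE x : `|x| = (nrm x)%:C.
Proof. by rewrite RRe_real // ger0_real. Qed.

Lemma nrm_ge0 x : 0 <= nrm x.
Proof. by rewrite -lecR -nrmE; exact: normr_ge0. Qed.

Lemma nrmD x y : nrm (x + y) <= nrm x + nrm y.
Proof. by rewrite -lecR rmorphD /= -!nrmE ler_normD. Qed.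

Lemma nrmN x : nrm (- x) = nrm x.
Proof. by rewrite /nrm normrN. Qed.

Lemma nrm0 : nrm 0 = 0.
Proof. by rewrite /nrm normr0. Qed.

Lemma nrm0_eq0 x : nrm x = 0 -> x = 0.
Proof. by move=> x0; apply/eqP; rewrite -normr_eq0 nrmE x0; exact: eqxx. Qed.

End RealNorm.

Arguments nrm {R U} x.

Section HilbertGeometry.
Variables (R : realType) (H : hilbertType R).
Implicit Types (u v w x y z : H).

Lemma inner_conj u v : inner u v = conjC (inner v u).
Proof. by rewrite hermC expr0 mul1r. Qed.

Lemma norm_inner_le u v : `|inner u v| <= `|u| * `|v|.
Proof.
have [->|v0] := eqVneq v 0; first by rewrite linear0r !normr0 mulr0.
rewrite -(@ler_pXn2r _ 2) ?nnegrE ?mulr_ge0 // exprMn normCK.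
set a := inner u v; set b := inner v v.
have bE : b = `|v| ^+ 2 by exact: inner_norm.
have b_gt0 : 0 < b by rewrite bE exprn_gt0 // normr_gt0.
have bC : conjC b = b by apply/conj_Creal/ger0_real/ltW.
have := dnorm_ge0 inner (b *: u - a *: v).
rewrite linearBl /= !linearBr /= !linearZl_LR /= !linearZr_LR /=.
rewrite (inner_conj v u) -/a -/b bC -bE -(inner_norm u) => h.
rewrite -subr_ge0 -(pmulr_rge0 _ b_gt0).
by move: h; congr (0 <= _); ring.
Qed.

Lemma nrm_inner_le u v : nrm (inner u v) <= nrm u * nrm v.
Proof. by rewrite -lecR rmorphM /= -!nrmE; exact: norm_inner_le. Qed.

Lemma parallelogram x y :
  nrm (x - y) ^+ 2 + nrm (x + y) ^+ 2 = 2 * nrm x ^+ 2 + 2 * nrm y ^+ 2.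
Proof.
apply: (@complexI R); rewrite !rmorphD !rmorphM rmorph_nat /= -!expr2.
rewrite -!nrmE -!inner_norm linearBl /= !linearBr linearDl /= !linearDr /=.
by ring.
Qed.

Lemma nrm_half x : nrm (2^-1 *: x) = 2^-1 * nrm x.
Proof.
apply: (@complexI R); rewrite rmorphM fmorphV rmorph_nat /= -!nrmE normrZ.
by rewrite normfV normr_nat.
Qed.

Lemma nrm_sub_midpoint (r : R) x y : r <= nrm (2^-1 *: (x + y)) -> 0 <= r ->
  nrm (x - y) ^+ 2 <= 2 * nrm x ^+ 2 + 2 * nrm y ^+ 2 - 4 * r ^+ 2.
Proof.
rewrite nrm_half => rm r0; rewrite -parallelogram.
have := nrm_ge0 (x + y); nra.
Qed.

(** Stability under midpoints, which for closed sets amounts to convexity. *)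
Definition midpoint_convex (C : set H) :=
  forall x y, C x -> C y -> C (2^-1 *: (x + y)).

(** The projection theorem for the origin. *)
Lemma min_norm_exists (C : set H) : C !=set0 -> midpoint_convex C ->
  closed C -> exists2 z, C z & forall y, C y -> nrm z <= nrm y.
Proof.
move=> [x0 Cx0] midC clC.
pose N := nrm @` C; pose r := inf N.
have N_inf : has_inf N.
  split; first by exists (nrm x0), x0.
  by exists 0 => _ [x _ <-]; exact: nrm_ge0.
have r_le x : C x -> r <= nrm x.
  by move=> Cx; apply: ge_inf; [case: N_inf|exists x].
have r_ge0 : 0 <= r.
  apply: lb_le_inf; first by case: N_inf.
  by move=> _ [x _ <-]; exact: nrm_ge0.
(* The elements of almost minimal norm generate a Cauchy filter. *)
pose B (e : R) := C `&` [set x | nrm x < r + e].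
pose FF := filter_from [set e : R | 0 < e] B.
have FF_filter : Filter FF.
  apply: filter_from_filter; first by exists 1 => /=.
  move=> e f /= e0 f0; exists (Num.min e f); first by rewrite /= lt_min e0.
  move=> x [Cx /= xm]; split; split=> //=; apply: lt_le_trans xm _.
    by rewrite lerD2l ge_min lexx.
  by rewrite lerD2l ge_min lexx orbT.
have FF_proper : ProperFilter FF.
  apply: filter_from_proper => e /= e0.
  by have [_ [x Cx <-] xe] := inf_adherent e0 N_inf; exists x.
have FF_cvg : cvg FF.
  apply/cauchy_cvgP/cauchy_exP => e e0.
  have [e' eE] : exists e', e = e'%:C.
    by exists (complex.Re e); rewrite RRe_real // gtr0_real.
  have e'0 : 0 < e' by rewrite -ltcR -eE.
  (* With [t <= 1], the parallelogram identity bounds the squared distance of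
     two elements of [B t] by [4 * (r + t) ^+ 2 - 4 * r ^+ 2], which is at most
     [t * (8 * r + 4)]. *)
  pose t := Num.min 1 (e' ^+ 2 / (8 * r + 5)).
  have den0 : 0 < 8 * r + 5 by lra.
  have t0 : 0 < t by rewrite lt_min ltr01 divr_gt0 // exprn_gt0.
  have t1 : t <= 1 by rewrite ge_min lexx.
  have te : t * (8 * r + 5) <= e' ^+ 2.
    by rewrite -ler_pdivlMr // ge_min lexx orbT.
  have [_ [x Cx <-] xt] := inf_adherent t0 N_inf.
  exists x, t => //= y [Cy /= yt].
  rewrite -ball_normE /= nrmE eE ltcR.
  rewrite -(@ltr_pXn2r _ 2) ?nnegrE ?nrm_ge0 ?ltW //.
  apply: le_lt_trans (nrm_sub_midpoint (r_le _ (midC _ _ Cx Cy)) r_ge0) _.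
  have := nrm_ge0 x; have := nrm_ge0 y; rewrite -/r in xt => y0 x0'.
  nra.
exists (lim FF).
  apply: (@closed_cvg _ _ FF _ id C clC _ _ FF_cvg).
  by exists 1 => //= x [].
move=> y Cy; apply: le_trans (r_le _ Cy).
apply/ler_addgt0Pr => e e0.
have e20 : 0 < e / 2 by rewrite divr_gt0.
have : FF (ball (lim FF) (e / 2)%:C).
  by apply: FF_cvg; apply: nbhsx_ballx; rewrite ltcR.
move=> /filterI/(_ (_ : FF (B (e/2)))) [].
  by exists (e / 2).
move=> f f0 Bf; have [_ [x Cx <-] xf] := inf_adherent f0 N_inf.
have [/=] := Bf x (conj Cx xf).
rewrite -ball_normE /= nrmE ltcR => zx [_ /= xe].
by have := nrmD (lim FF - x) x; rewrite subrK; lra.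
Qed.

(** The element of smallest norm of a convex set is unique, so every isometry
    that preserves the set fixes it. *)
Lemma min_norm_unique (C : set H) x y : midpoint_convex C -> C x -> C y ->
  (forall z, C z -> nrm x <= nrm z) -> nrm y = nrm x -> y = x.
Proof.
move=> midC Cx Cy minx yx; apply/eqP; rewrite -subr_eq0; apply/eqP/nrm0_eq0.
have := nrm_sub_midpoint (minx _ (midC _ _ Cy Cx)) (nrm_ge0 x).
have := nrm_ge0 (y - x); rewrite yx => h1 h2.
by apply/eqP; rewrite -sqrf_eq0; apply/eqP; nra.
Qed.

End HilbertGeometry.

(** * Vectors fixed by contracted elements *)

Section UnitaryRepresentations.
Variables (R : realType) (G : topologicalGroupType) (H : hilbertType R).
Variable pi : unitary_rep G H.
Implicit Types (g h u : G) (v w x y : H).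

Lemma rep_one v : pi 1%g v = v.
Proof.
have [/bij_inj inj _] := rep_unitary pi 1%g.
by apply: inj; rewrite -rep_mul mulg1.
Qed.

Lemma inner_rep g v w : inner (pi g v) (pi g w) = inner v w.
Proof. exact: (rep_unitary pi g).2. Qed.

Lemma nrm_rep g v : nrm (pi g v) = nrm v.
Proof.
apply/eqP; rewrite -(@eqrXn2 _ 2) ?nrm_ge0 // -(inj_eq (@complexI R)).
by rewrite !rmorphXn /= -!nrmE -!inner_norm inner_rep.
Qed.

Lemma nrm_inner_half v w : nrm (inner v (2^-1 *: w)) = 2^-1 * nrm (inner v w).
Proof.
apply: (@complexI R); rewrite rmorphM fmorphV rmorph_nat /= -!nrmE.
by rewrite linearZr_LR /= normrM norm_conjC normfV normr_nat.
Qed.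

Lemma near_rep v g (e : R) : 0 < e ->
  \forall h \near g, nrm (pi g v - pi h v) < e.
Proof.
move=> e0; have /cvg_ballP /(_ e%:C) := @rep_strongly_continuous _ _ _ pi v g.
rewrite ltcR => /(_ e0); apply: filterS => h.
by rewrite -ball_normE /= nrmE ltcR.
Qed.

Lemma superlevel_closed v w (e : R) :
  closed [set g | e%:C <= `|matrix_coef pi v w g|].
Proof.
move=> p clp /=; rewrite /matrix_coef nrmE lecR leNgt; apply/negP => pe.
pose t := (e - nrm (inner (pi p v) w)) / (nrm w + 1).
have w1 : 0 < nrm w + 1 by have := nrm_ge0 w; lra.
have t0 : 0 < t by rewrite divr_gt0 // subr_gt0.
have [g [/=]] := clp _ (near_rep v p t0).
rewrite /matrix_coef nrmE lecR => eg gt.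
have := nrmD (inner (pi p v) w) (- inner (pi p v - pi g v) w).
rewrite nrmN -linearNl opprB -linearDl addrC subrK => h1.
have := nrm_inner_le (pi p v - pi g v) w.
have : t * (nrm w + 1) = e - nrm (inner (pi p v) w).
  by rewrite mulfVK // gt_eqF.
have := nrm_ge0 w; nra.
Qed.

Lemma isotropy_closed v : closed (isotropy pi v).
Proof.
move=> p clp; rewrite /isotropy /=; apply/eqP; rewrite -subr_eq0.
apply/eqP/nrm0_eq0/eqP; rewrite eq_le nrm_ge0 andbT.
apply/ler_addgt0Pr => e e0; rewrite add0r.
by have [g [/= gv]] := clp _ (near_rep v p e0); rewrite gv => /ltW.
Qed.

(** If matrix coefficients stay away from zero along a filter, then some
    non-zero vector is fixed by every [u] whose conjugates [g^-1 u g] tend to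
    the identity.  It is the shortest vector [x] whose coefficients
    [inner (pi g v) x] are asymptotic to those of [w]. *)
Lemma contracted_fixed_vector (FF : set_system G) v w (e : R) :
  ProperFilter FF -> 0 < e -> FF [set g | e%:C <= `|matrix_coef pi v w g|] ->
  exists2 x, x <> 0 & forall u,
    (g^-1 * u * g)%g @[g --> FF] --> 1%g -> pi u x = x.
Proof.
move=> FF_proper e0 FFe.
pose C := [set x | forall t : R, 0 < t ->
  FF [set g | nrm (inner (pi g v) (x - w)) < t]].
have Cw : C w.
  by move=> t t0; apply: nearW => g /=; rewrite subrr linear0r nrm0.
have C_mid : midpoint_convex C.
  move=> x y Cx Cy t t0; apply: filterS2 (Cx t t0) (Cy t t0) => g /= gx gy.
  have -> : 2^-1 *: (x + y) - w = 2^-1 *: ((x - w) + (y - w)).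
    rewrite addrACA -opprD scalerBr; congr (_ - _).
    by rewrite scalerDr -scalerDl -[2^-1]mul1r -splitr scale1r.
  rewrite nrm_inner_half linearDr.
  by have := nrmD (inner (pi g v) (x - w)) (inner (pi g v) (y - w)); lra.
have C_closed : closed C.
  move=> x clx t t0.
  pose r := t / 2 / (nrm v + 1).
  have v1 : 0 < nrm v + 1 by have := nrm_ge0 v; lra.
  have r0 : 0 < r by rewrite !divr_gt0.
  have [|y [Cy]] := clx (ball x r%:C).
    by apply: nbhsx_ballx; rewrite ltcR.
  rewrite -ball_normE /= nrmE ltcR => xy.
  have t20 : 0 < t / 2 by rewrite divr_gt0.
  apply: filterS (Cy _ t20) => g /= gy.
  have -> : x - w = (x - y) + (y - w) by rewrite addrA subrK.
  rewrite linearDr; apply: le_lt_trans (nrmD _ _) _.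
  have := nrm_inner_le (pi g v) (x - y); rewrite nrm_rep.
  have : r * (nrm v + 1) = t / 2 by rewrite mulfVK // gt_eqF.
  by have := nrm_ge0 v; nra.
have C_inv u x : (g^-1 * u * g)%g @[g --> FF] --> 1%g -> C x -> C (pi u x).
  move=> FFu Cx t t0.
  pose r := t / 2 / (nrm x + 1).
  have x1 : 0 < nrm x + 1 by have := nrm_ge0 x; lra.
  have r0 : 0 < r by rewrite !divr_gt0.
  have t20 : 0 < t / 2 by rewrite divr_gt0.
  have FFr : FF [set g | nrm (pi 1%g v - pi (g^-1 * u * g)%g v) < r].
    exact: (FFu _ (near_rep v 1%g r0)).
  apply: filterS2 (Cx _ t20) FFr => g /= gx.
  rewrite rep_one => gr.
  (* Here [u g v = g h v] with [h = g^-1 u g] close to the identity. *)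
  have -> : inner (pi g v) (pi u x - w) =
      inner (pi g (v - pi (g^-1 * u * g)%g v)) (pi u x) +
      inner (pi g v) (x - w).
    rewrite !linearBr /= linearB linearBl /= -rep_mul !mulgA mulgV mul1g.
    by rewrite rep_mul inner_rep addrA subrK.
  apply: le_lt_trans (nrmD _ _) _.
  have := nrm_inner_le (pi g (v - pi (g^-1 * u * g)%g v)) (pi u x).
  rewrite !nrm_rep.
  have : r * (nrm x + 1) = t / 2 by rewrite mulfVK // gt_eqF.
  by have := nrm_ge0 x; nra.
have [x Cx xmin] := min_norm_exists (ex_intro _ w Cw) C_mid C_closed.
exists x => [x0|u FFu].
  have [g /= []] := filter_ex (filterI FFe (Cx e e0)).
  by rewrite /matrix_coef nrmE lecR x0 sub0r linearNr nrmN leNgt => /negP.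
apply: (min_norm_unique C_mid) Cx (C_inv _ _ FFu Cx) xmin _; exact: nrm_rep.
Qed.

End UnitaryRepresentations.

(** * Point stabilizers of primitive groups *)

Section PrimitiveGroups.
Variables (d : nat) (F : {group 'S_d}).
Local Open Scope group_scope.
Local Notation stab c := 'C_F[c | 'P]%g.

(** If the stabilizer of [c] also fixes [i], an element of [F] that takes [c] to
    [i] normalizes it.  As point stabilizers are maximal, the stabilizer of [c]
    is then normal in [F], and trivial because it is not transitive.  So the
    trivial group is maximal in [F], and [F] is cyclic of prime order. *)
Lemma primitive_stab_moves (c i : 'I_d) :
  [primitive F, on [set: 'I_d]%SET | 'P] -> ~ (cyclic F /\ prime #|F|) ->
  i != c -> exists s : 'S_d, [/\ s \in F, s c = c & s i != i].
Proof.
move=> primF ncp ic.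
have [trF _] := andP primF.
have faith (H : {group 'S_d}) :
    H \subset 'C_F([set: 'I_d]%SET | 'P) -> H :=: 1%g.
  move=> /fintype.subsetP HC; apply/trivgP/fintype.subsetP => s.
  move=> /HC /setIP[_ /astabP sx]; apply/set1P/permP => x.
  by rewrite perm1; exact: (sx x (finset.in_setT _)).
have maxS x : maximal_eq (stab x) F.
  by rewrite -(trans_prim_astab (finset.in_setT x) trF).
pose moves (s : 'S_d) := [&& s \in F, s c == c & s i != i].
have [[s /and3P[sF /eqP sc si]]|nmove] := altP (@existsP _ moves).
  by exists s.
case: ncp.
have ci : stab c \subset stab i.
  apply/fintype.subsetP => s /setIP[sF /astab1P sc]; apply/setIP; split=> //.
  apply/astab1P; apply: contraNeq nmove => si.
  by apply/existsP; exists s; rewrite /moves sF si andbT; apply/eqP.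
have [g gF gi] := atransP2 trF (finset.in_setT c) (finset.in_setT i).
have stabJ : stab c :^ g = stab i.
  by rewrite conjIg (conjGid gF) gi astab1_act.
have gN : g \in 'N_F(stab c).
  rewrite inE gF /=; apply/normP/eqP.
  by rewrite eq_sym eqEcard stabJ ci /= -stabJ cardJg.
have stabF : 'N_F(stab c) = F.
  have [_ maxc] := maximal_eqP _ _ (maxS c).
  have [] := maxc 'N_F(stab c)%G.
  - by rewrite finset.subsetI finset.subsetIl normG.
  - exact: finset.subsetIl.
  - move=> NE; move: gN; rewrite NE => /setIP[_ /astab1P].
    by move=> gc; move: ic; rewrite gi gc eqxx.
  - by [].
have stab1 : stab c :=: 1%g.
  have [|trc|] := prim_trans_norm primF (_ : stab c <| F).
  - by rewrite /normal finset.subsetIl -{1}stabF finset.subsetIr.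
  - by rewrite (faith _ trc).
  move=> trc.
  have [h hc hi] := atransP2 trc (finset.in_setT c) (finset.in_setT i).
  by move: hc => /setIP[_ /astab1P h']; move: ic; rewrite hi h' eqxx.
have [_ max1] := maximal_eqP _ _ (maxS c).
have F_gt1 : (1 < #|F|)%N.
  rewrite cardG_gt1; apply/eqP => F1.
  by move: gF; rewrite F1 => /set1P g1; move: ic; rewrite gi g1 act1 eqxx.
have [p p_pr pF] := pdivP F_gt1.
have [x xF xp] := Cauchy p_pr pF.
have [||x1|xE] := max1 <[x]>%G.
- by have := sub1G <[x]>; rewrite -stab1.
- by rewrite cycle_subG.
- move: p_pr; rewrite -xp /order x1.
  by suff -> : #|stab c| = 1%N by []; rewrite stab1 cards1.
by rewrite -xE cycle_cyclic -/(order x) xp.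
Qed.
End PrimitiveGroups.

(** * Words of colors in a regularly edge-colored tree *)

(** A word is reduced when no two consecutive letters are equal. *)
Definition reduced (I : eqType) (w : seq I) := sorted (fun i j => i != j) w.

(** A tree with a legal coloring is encoded by the map [nb], which sends a
    vertex [v] and a color [i] to the neighbor of [v] across the edge of color
    [i].  A path is then a starting point together with its word of colors, and
    it is free of backtracking when that word is reduced. *)
Record colored_tree (V : Type) (I : eqType) := ColoredTree {
  nb :> V -> I -> V ;
  nbK : forall v i, nb (nb v i) i = v ;
  nb_connected : forall v z, exists w, foldl nb v w = z ;
  nb_acyclic : forall v w, reduced w -> foldl nb v w = v -> w = [::]
}.

Section Words.
Variables (V : Type) (I : eqType) (nb : colored_tree V I).
Implicit Types (v z : V) (i j : I) (w : seq I).

Local Notation walk := (foldl nb).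

Lemma reduced_cons i w : reduced (i :: w) -> reduced w.
Proof. exact: path_sorted. Qed.

Lemma reduced_consE i j w :
  reduced (i :: j :: w) = (i != j) && reduced (j :: w).
Proof. by []. Qed.

Lemma reduced_rev w : reduced (rev w) = reduced w.
Proof.
rewrite /reduced rev_sorted; case: w => //= i w.
by apply: eq_path => j k /=; rewrite eq_sym.
Qed.

Lemma reduced_map (s : I -> I) w : injective s ->
  reduced (map s w) = reduced w.
Proof.
move=> s_inj; rewrite /reduced sorted_map.
by apply: eq_sorted => i j /=; rewrite (inj_eq s_inj).
Qed.

Lemma reduced_rcons_cat i j w w' : reduced (rcons w i) -> reduced (j :: w') ->
  i != j -> reduced (rcons w i ++ j :: w').
Proof.
move=> wi jw' ij; rewrite /reduced.
case: w wi => [|k w] /=; first by rewrite ij.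
by rewrite cat_path /= last_rcons ij => ->.
Qed.

Lemma walk_rev v w : walk (walk v w) (rev w) = v.
Proof.
elim: w v => //= i w IH v.
by rewrite rev_cons -cats1 foldl_cat IH /= nbK.
Qed.

Lemma nb_inj v : injective (nb v).
Proof.
move=> i j vij; apply/eqP/negPn/negP => ij.
have := @nb_acyclic _ _ nb v [:: i; j].
by rewrite /= ij vij nbK => /(_ isT erefl).
Qed.

Lemma walk_inj v w w' : reduced w -> reduced w' -> walk v w = walk v w' ->
  w = w'.
Proof.
elim: w v w' => [|i w IH] v [|j w'] //.
- by move=> _ rw' /esym /(nb_acyclic rw').
- by move=> rw _ /(nb_acyclic rw).
move=> rw rw'; have [<- /= vw|ij vw] := eqVneq i j.
  congr (_ :: _).
  exact: IH (reduced_cons rw) (reduced_cons rw') vw.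
(* Running back along [w'] and then along [w] would be a closed geodesic. *)
have r : reduced (rev (j :: w') ++ i :: w).
  rewrite rev_cons; apply: reduced_rcons_cat => //; last by rewrite eq_sym.
  by rewrite -rev_cons reduced_rev.
have back : walk (walk v (j :: w')) (rev (j :: w') ++ i :: w) =
    walk v (j :: w').
  by rewrite foldl_cat walk_rev.
have /(congr1 size) := nb_acyclic r back.
by rewrite size_cat addnS.
Qed.

(** Cancelling the backtracks in a word does not depend on the starting point
    and commutes with a permutation of the colors. *)
Lemma reduction w : exists2 w', reduced w' & forall (s : I -> I) v,
  walk v (map s w') = walk v (map s w).
Proof.
elim: w => [|i w [w' rw' ww']]; first by exists [::].
case: w' rw' ww' => [|j w'] rw' ww'.
  by exists [:: i] => // s v /=; rewrite -ww'.
have [ij|ij] := eqVneq i j.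
  exists w'; first exact: reduced_cons rw'.
  by move=> s v /=; rewrite -ww' /= -ij nbK.
by exists (i :: j :: w') => [|s v]; rewrite ?reduced_consE ?ij //= -ww'.
Qed.

Lemma reduced_word_exists v z : exists w, reduced w /\ walk v w = z.
Proof.
have [w <-] := nb_connected nb v z; have [w' rw' ww'] := reduction w.
by exists w'; split=> //; have := ww' id v; rewrite !map_id.
Qed.

(** The word of colors along the geodesic from [v] to [z]. *)
Definition word v z : seq I := projT1 (cid (reduced_word_exists v z)).

Lemma word_reduced v z : reduced (word v z).
Proof. by rewrite /word; case: cid => w []. Qed.

Lemma walk_word v z : walk v (word v z) = z.
Proof. by rewrite /word; case: cid => w []. Qed.

Lemma word_walk v w : reduced w -> word v (walk v w) = w.
Proof.
by move=> rw; apply: walk_inj (walk_word _ _) => //; exact: word_reduced.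
Qed.

(** The half-tree of all vertices whose geodesic from [v] starts with the edge
    of color [i]. *)
Definition half_tree v i : set V :=
  [set z | exists2 w, reduced (i :: w) & z = walk v (i :: w)].

Lemma half_tree_nb v i : half_tree v i (nb v i).
Proof. by exists [::]. Qed.

Lemma half_tree_root v i : ~ half_tree v i v.
Proof. by move=> [w rw /esym /(nb_acyclic rw)]. Qed.

Lemma half_tree_sub v i j : i != j ->
  half_tree (nb v i) j `<=` half_tree v i.
Proof.
by move=> ij z [w rw ->]; exists (j :: w) => //; rewrite reduced_consE ij.
Qed.

(** The edge from [v] of color [i] is the only one that leaves the
    half-tree. *)
Lemma half_tree_edge v i z j : half_tree v i z ->
  half_tree v i (nb z j) \/ [/\ nb z j = v, j = i & z = nb v i].
Proof.
move=> [w rw ->]; case/lastP: w rw => [|w k] rw /=.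
  have [<-|ij] := eqVneq i j; first by right; rewrite nbK.
  by left; exists [:: j]; rewrite //= ij.
rewrite foldl_rcons; have [<-|kj] := eqVneq k j.
  left; exists w; rewrite ?nbK //.
  by move: rw; rewrite -rcons_cons /reduced /= rcons_path => /andP[].
left; exists (rcons (rcons w k) j); last by rewrite /= !foldl_rcons.
by move: rw; rewrite /reduced /= !rcons_path last_rcons => /andP[-> ->].
Qed.

(** ** Maps that permute the colors at every vertex *)

(** [s z] is the local action of [f] at [z]. *)
Definition local_morphism (f : V -> V) (s : V -> I -> I) :=
  forall z j, f (nb z j) = nb (f z) (s z j).

Lemma local_morphism_walk f s v w : local_morphism f s ->
  (forall z, injective (s z)) -> reduced w -> exists w',
    [/\ reduced w', size w' = size w & f (walk v w) = walk (f v) w'].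
Proof.
move=> fs s_inj; suff H : forall i w, reduced (i :: w) -> exists2 w',
    reduced (s v i :: w') &
    size w' = size w /\ f (walk v (i :: w)) = walk (f v) (s v i :: w').
  case: w => [_|i w /H [w' rw' [sw' fw']]]; first by exists [::].
  by exists (s v i :: w') => /=; rewrite sw'.
move=> {w} i w; elim: w v i => [|j w IH] v i.
  by exists [::] => //=; rewrite fs.
rewrite reduced_consE => /andP[ij /(IH (nb v i))[w' rw' [sw' fw']]].
exists (s (nb v i) j :: w').
  have -> : s v i = s (nb v i) i.
    by apply: (@nb_inj (f (nb v i))); rewrite -fs nbK fs nbK.
  by rewrite reduced_consE rw' (inj_eq (s_inj _)) ij.
by rewrite /= sw'; split=> //; rewrite -fs /=; exact: fw'.
Qed.

(** A local isomorphism of trees preserves reduced words, hence is injective;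
    its image is closed under taking neighbors. *)
Lemma local_morphism_bij f s : local_morphism f s ->
  (forall z, bijective (s z)) -> bijective f.
Proof.
move=> fs s_bij; have s_inj z : injective (s z) := bij_inj (s_bij z).
have f_inj : injective f.
  move=> y z fyz; rewrite -(walk_word y z).
  have [w' [rw' sw' fw']] := local_morphism_walk y fs s_inj (word_reduced y z).
  have w'0 : w' = [::].
    by apply: (@nb_acyclic _ _ nb (f y) w' rw'); rewrite -fw' walk_word -fyz.
  by have /eqP := esym sw'; rewrite w'0 size_eq0 => /eqP ->.
have f_surj z : exists y, f y = z.
  have [w <-] := nb_connected nb (f z) z.
  elim/last_ind: w => [|w k [y IH]]; first by exists z.
  have [t tK Kt] := s_bij y.
  by exists (nb y (t k)); rewrite fs foldl_rcons -IH Kt.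
pose g z := projT1 (cid (f_surj z)).
have gK : cancel g f by move=> z; rewrite /g; case: cid.
by exists g => // z; apply: f_inj; rewrite gK.
Qed.

(** ** Twisting one side of an edge *)

(** Permuting by [s] the colors of all geodesics from [v] is an automorphism
    with local action [s] everywhere.  When [s] fixes the color [i], it fixes
    both ends of the edge from [v] of color [i], so it can be replaced by the
    identity on the half-tree behind that edge; the result is [twist]. *)
Definition rotation (s : I -> I) v z := walk v (map s (word v z)).

Definition twist (s : I -> I) v i z :=
  if `[< half_tree v i z >] then z else rotation s v z.

Lemma rotation_walk s v w : rotation s v (walk v w) = walk v (map s w).
Proof.
have [w' rw' ww'] := reduction w.
have := ww' id v; rewrite !map_id => <-.
by rewrite /rotation word_walk.
Qed.

Lemma rotation_nb s v z j : rotation s v (nb z j) = nb (rotation s v z) (s j).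
Proof.
rewrite -{1}(walk_word v z) -foldl_rcons rotation_walk map_rcons foldl_rcons.
by rewrite -rotation_walk walk_word.
Qed.

Lemma rotation_root s v : rotation s v v = v.
Proof. exact: (rotation_walk s v [::]). Qed.

Lemma twist_id s v i z : half_tree v i z -> twist s v i z = z.
Proof. by rewrite /twist => /asboolT ->. Qed.

Lemma twist_root s v i : twist s v i v = v.
Proof. by rewrite /twist asboolF ?rotation_root //; exact: half_tree_root. Qed.

Lemma twist_local s v i : s i = i -> local_morphism (twist s v i)
  (fun z j => if `[< half_tree v i z >] then j else s j).
Proof.
move=> si z j; case: asboolP => [Tz|nTz].
  rewrite [in RHS]twist_id //.
  have [Tzj|[-> _ _]] := half_tree_edge j Tz; first by rewrite twist_id.
  by rewrite twist_root.
have [Tzj|nTzj] := pselect (half_tree v i (nb z j)).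
  rewrite twist_id //; have := half_tree_edge j Tzj.
  rewrite nbK => -[//|[zv ji _]].
  by rewrite zv twist_root ji si.
by rewrite /twist !asboolF // rotation_nb.
Qed.

(** If [s] moves the color by which the geodesic from [x] arrives at the
    twisted edge, then the geodesic from [x] to its image runs to that edge and
    as far again, through the permuted colors in reverse order. *)
Lemma twist_word s x w k i : injective s -> reduced (rcons w k) ->
  k != i -> s i = i -> s k != k ->
  word x (twist s (walk x (rcons w k)) i x) =
  rcons w k ++ map s (rev (rcons w k)).
Proof.
move=> s_inj rwk ki si sk; set v := walk x _.
have vx : walk v (rev (rcons w k)) = x by exact: walk_rev.
have nT : ~ half_tree v i x.
  move=> [u ru]; rewrite -{1}vx => /walk_inj.
  rewrite reduced_rev => /(_ rwk ru); rewrite rev_rcons => -[].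
  by move/eqP; rewrite (negbTE ki).
have -> : twist s v i x = walk x (rcons w k ++ map s (rev (rcons w k))).
  by rewrite /twist asboolF // -{1}vx rotation_walk foldl_cat.
apply: word_walk; rewrite rev_rcons /=; apply: reduced_rcons_cat => //.
  by rewrite -map_cons -rev_rcons reduced_map // reduced_rev.
by rewrite eq_sym.
Qed.

End Words.

(** * The colored tree of a legal coloring *)

Section LegalColoring.
Variables (d : nat) (V : choiceType) (adj : rel V) (iota : set V -> 'I_d).
Hypotheses (adj_tree : tree adj) (iota_legal : legal_coloring adj iota).

Lemma color_neighbor_exists v i : exists y, adj v y /\ iota [set v; y] = i.
Proof.
have [_ _ surj] := iota_legal v.
have [_ [[a [b [ab ->]]] /= vE] <-] := surj i I.
case: vE => ->; first by exists b.
by exists a; rewrite (tree_sym adj_tree) setUC.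
Qed.

(** The neighbor of [v] across its edge of color [i]. *)
Definition neighbor v i : V := projT1 (cid (color_neighbor_exists v i)).

Lemma adj_neighbor v i : adj v (neighbor v i).
Proof. by rewrite /neighbor; case: cid => y []. Qed.

Lemma color_neighbor v i : iota [set v; neighbor v i] = i.
Proof. by rewrite /neighbor; case: cid => y []. Qed.

Lemma neighbor_color v y : adj v y -> neighbor v (iota [set v; y]) = y.
Proof.
move=> vy; set z := neighbor v _.
have vz : adj v z by exact: adj_neighbor.
have [_ inj _] := iota_legal v.
have : [set v; z] = [set v; y].
  apply: inj; rewrite ?color_neighbor //; apply/mem_set.
    by split; [exists v, z | left].
  by split; [exists v, y | left].
move=> /seteqP[/(_ z (or_intror erefl))] [/= zv|//] _.
by move: vz; rewrite zv (tree_irrefl adj_tree).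
Qed.

Lemma neighborK v i : neighbor (neighbor v i) i = v.
Proof.
rewrite -{2}(color_neighbor v i) setUC neighbor_color //.
by rewrite (tree_sym adj_tree) adj_neighbor.
Qed.

Lemma neighbor_inj v : injective (neighbor v).
Proof.
by move=> i j vij; rewrite -(color_neighbor v i) vij color_neighbor.
Qed.

Lemma neighbor_connected v z : exists w, foldl neighbor v w = z.
Proof.
have [p vp <-] := tree_connected adj_tree v z.
elim: p v vp => [|y p IH] v /=; first by exists [::].
move=> /andP[vy /IH [w <-]]; exists (iota [set v; y] :: w) => /=.
by rewrite neighbor_color.
Qed.

Lemma path_scanl_neighbor v w : path adj v (scanl neighbor v w).
Proof. by elim: w v => //= i w IH v; rewrite adj_neighbor IH. Qed.

Lemma last_scanl_neighbor v w :
  last v (scanl neighbor v w) = foldl neighbor v w.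
Proof. by elim: w v => //= i w IH v; rewrite IH. Qed.

(** A shortest closed reduced word visits distinct vertices. *)
Lemma neighbor_acyclic v w :
  reduced w -> foldl neighbor v w = v -> w = [::].
Proof.
have [n] := ubnP (size w); elim: n v w => // n IH v w wn rw vw.
case wE : w => [//|i w'].
have cyc : path.cycle adj (scanl neighbor v w).
  by rewrite (cycle_path v) last_scanl_neighbor vw path_scanl_neighbor.
have /negPn : ~~ ~~ uniq (scanl neighbor v w).
  apply/negP => /(uniqPn v) [k [l [kl]]]; rewrite size_scanl => lw.
  rewrite !nth_scanl ?(ltn_trans kl lw) //.
  rewrite (_ : l.+1 = k.+1 + (l - k))%N; last by rewrite addSn subnKC // ltnW.
  rewrite takeD foldl_cat => /esym; set u := take _ (drop _ _) => /IH u0.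
  have su : size u = (l - k)%N.
    by rewrite size_takel // size_drop -subSS leq_sub2r.
  have /(congr1 size) : u = [::].
    apply: u0; last exact/take_sorted/drop_sorted.
    by rewrite su (leq_ltn_trans (leq_subr k l)) // (leq_trans lw).
  by rewrite su => /eqP; rewrite subn_eq0 leqNgt kl.
move=> u.
have /(tree_acyclic adj_tree) : ucycle adj (scanl neighbor v w) by apply/andP.
rewrite size_scanl; move: rw vw; rewrite wE; case: w' {wE} => [|j [|//]] /=.
  by move=> _ vi; have := adj_neighbor v i; rewrite vi (tree_irrefl adj_tree).
rewrite andbT => ij /(congr1 (neighbor^~ j)); rewrite neighborK.
by move=> /neighbor_inj/eqP; rewrite (negbTE ij).
Qed.

(** The tree with the coloring [iota]. *)
Definition legal_tree : colored_tree V 'I_d :=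
  ColoredTree neighborK neighbor_connected neighbor_acyclic.

End LegalColoring.

(** * The universal group through its local actions *)

Section UniversalGroupPlus.
Variables (d : nat) (V : choiceType) (adj : rel V) (iota : set V -> 'I_d).
Hypotheses (adj_tree : tree adj) (iota_legal : legal_coloring adj iota).
Variable F : {group 'S_d}.

Local Notation nbr := (legal_tree adj_tree iota_legal).
Local Notation G := (universal_group_plus adj iota F).
Local Notation plus_carrier := (Defs.generated
  [set g : tree_aut adj | universal_group iota F g /\ fixes_edge g]).

(** The action of [U(F)^+] on the vertices. *)
Definition vact (g : G) (x : V) : V := (val g : tree_aut adj) x.

(** All local actions of [f] belong to [F]. *)
Definition locally_in (f : V -> V) := forall v, exists2 s : 'S_d,
  s \in F & forall j, f (nbr v j) = nbr (f v) (s j).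

Lemma adjE x y : adj x y -> y = nbr x (iota [set x; y]).
Proof. by move=> xy; rewrite /= neighbor_color. Qed.

Lemma local_actionE (g : tree_aut adj) x i :
  local_action iota g x i = iota [set g x; g (nbr x i)].
Proof.
have [_ inj _] := iota_legal x.
have xi : adj x (nbr x i) by exact: adj_neighbor.
have xiE : star adj x [set x; nbr x i].
  by split; [exists x, (nbr x i) | left].
rewrite /local_action /= -{1}(color_neighbor adj_tree iota_legal x i).
rewrite (pinvKV _ inj) ?inE // image_setU !image_set1.
by [].
Qed.

Lemma universal_groupP (g : tree_aut adj) :
  universal_group iota F g <-> locally_in g.
Proof.
split=> gF v; have [s sF gs] := gF v; exists s => //.
  move=> j; rewrite -gs local_actionE -adjE //.
  by rewrite (aut_funP g).2 adj_neighbor.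
by apply/funext => j; rewrite local_actionE gs color_neighbor.
Qed.

Lemma locally_in_automorphism f : locally_in f -> automorphism adj f.
Proof.
move=> fF.
have /choice[s fs'] : forall v, exists s : 'S_d,
    forall j, f (nbr v j) = nbr (f v) (s j).
  by move=> v; have [s _ sf] := fF v; exists s.
have fs : local_morphism nbr f (fun v => s v) by [].
have f_bij : bijective f.
  apply: local_morphism_bij fs _ => v.
  by exists (s v)^-1%g; [exact: permK | exact: permKV].
split=> // x y; apply/idP/idP => [fxy|/adjE ->]; last first.
  by rewrite fs; exact: adj_neighbor.
suff -> : y = nbr x ((s x)^-1%g (iota [set f x; f y])) by exact: adj_neighbor.
by apply: (bij_inj f_bij); rewrite fs permKV -adjE.
Qed.

Lemma locally_in_comp f g :
  locally_in f -> locally_in g -> locally_in (f \o g).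
Proof.
move=> fF gF v; have [s sF gs] := gF v; have [t tF ft] := fF (g v).
by exists (s * t)%g; [exact: groupM | move=> j /=; rewrite gs ft permM].
Qed.

Lemma locally_in_inv (g : tree_aut adj) :
  locally_in g -> locally_in (g^-1%g : tree_aut adj).
Proof.
move=> gF v; have [s sF gs] := gF ((g^-1%g : tree_aut adj) v).
exists s^-1%g; first by rewrite groupV.
move=> j; apply: (can_inj (aut_invK g)); rewrite gs !aut_invVK.
by rewrite permKV.
Qed.

Lemma universal_group_closed :
  monoid.group_closed (mem (universal_group (adj := adj) iota F)).
Proof.
split=> [|g h]; rewrite !inE.
  apply/universal_groupP => v; exists 1%g => // j.
  by rewrite perm1.
move=> /universal_groupP gF /universal_groupP hF; apply/universal_groupP.
exact/(locally_in_comp gF)/locally_in_inv.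
Qed.

Lemma plus_locally_in (g : G) : locally_in (vact g).
Proof.
apply/(universal_groupP (val g)).
have : plus_carrier (val g).
  by have := valP g; rewrite inE.
apply: smallest_sub => [|h []//]; exact: universal_group_closed.
Qed.

Lemma edge_fixer_in_plus f x y :
  locally_in f -> adj x y -> f x = x -> f y = y ->
  exists g : G, forall z, vact g z = f z.
Proof.
move=> fF xy fx fy; pose h := mk_aut (locally_in_automorphism fF).
have hA : plus_carrier h.
  move=> K [_]; apply; split; first exact/universal_groupP.
  by exists [set x; y]; [exists x, y | move=> z [] ->].
by exists (exist _ h (mem_set hA)).
Qed.

Lemma vact1 x : vact (1%g : G) x = x.
Proof. by []. Qed.

Lemma vactM (g h : G) x : vact (g * h)%g x = vact g (vact h x).
Proof. by []. Qed.

Lemma vactK (g : G) : cancel (vact g) (vact g^-1%g).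
Proof. by move=> x; rewrite -vactM mulVg. Qed.

(** [U(F)^+] is open in [U(F)]: agreeing with one of its elements on an edge is
    enough to belong to it. *)
Lemma locally_in_plus f x y (g0 : G) : locally_in f -> adj x y ->
  vact g0 x = f x -> vact g0 y = f y ->
  exists g : G, forall z, vact g z = f z.
Proof.
move=> fF xy gx gy.
pose k : tree_aut adj := (val g0)^-1%g.
have [|||h hE] := @edge_fixer_in_plus (k \o f) x y _ xy.
- exact/locally_in_comp/fF/locally_in_inv/plus_locally_in.
- by rewrite /= -gx aut_invK.
- by rewrite /= -gy aut_invK.
by exists (g0 * h)%g => z; rewrite vactM hE; exact: aut_invVK.
Qed.

(** The topology of [U(F)^+] is that of pointwise convergence on vertices. *)
Lemma plus_cvgP (FF : set_system G) (p : G) : Filter FF ->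
  FF --> p <-> forall x, FF [set g | vact g x = vact p x].
Proof.
move=> FFF; split=> [FFp x|FFp].
  apply: FFp.
  exact: (@initial_continuous G (tree_aut adj) val p _ (aut_nbhs _ x)).
move=> B [_ [[C oC <-] Cp CB]]; apply: filterS CB _.
have : val @ FF --> (val p : tree_aut adj) by apply/aut_cvgP => x; exact: FFp.
by apply; apply: open_nbhs_nbhs.
Qed.

Lemma act_nbr (g : G) v j : exists i, vact g (nbr v j) = nbr (vact g v) i.
Proof. by have [s _ gs] := plus_locally_in g v; exists (s j); exact: gs. Qed.

End UniversalGroupPlus.

(** * Limits of ultrafilters on the universal group *)

Section Ultrafilters.
Variables (T : Type) (FF : set_system T).
Context {FF_ultra : UltraFilter FF}.

Lemma ultra_finite (I : finType) (f : T -> I) : exists i, FF [set t | f t = i].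
Proof.
apply/not_existsP => H.
have : FF [set t | forall i, f t <> i].
  apply: filter_forall => i.
  by have [/H|] := in_ultra_setVsetC [set t | f t = i] FF_ultra.
by move=> /filter_ex[t /(_ (f t))].
Qed.

End Ultrafilters.

Section UltrafilterDynamics.
Variables (d : nat) (V : choiceType) (adj : rel V) (iota : set V -> 'I_d).
Hypotheses (adj_tree : tree adj) (iota_legal : legal_coloring adj iota).
Variable F : {group 'S_d}.

Local Notation nbr := (legal_tree adj_tree iota_legal).
Local Notation walk := (foldl nbr).
Local Notation G := (universal_group_plus adj iota F).

Variable FF : set_system G.
Context {FF_ultra : UltraFilter FF}.

(** The stabilizer of a vertex is compact, in the form that an ultrafilter
    along which the image of a vertex is constant converges. *)
Lemma ultra_fixed_cvg x y :
  FF [set g | vact g x = y] -> exists p : G, FF --> p.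
Proof.
move=> FFx.
have images z : exists z', FF [set g | vact g z = z'].
  have [w <-] := nb_connected nbr x z.
  elim/last_ind: w => [|w j [z' IH]]; first by exists y.
  have [i FFi] := ultra_finite (fun g : G =>
    iota [set vact g (walk x w); vact g (nbr (walk x w) j)]).
  exists (nbr z' i); apply: filterS2 IH FFi => g /= gz gi.
  have [k gk] := act_nbr adj_tree iota_legal g (walk x w) j.
  move: gi; rewrite foldl_rcons gk gz => <-.
  by rewrite color_neighbor.
have [h hP] := choice images.
have h_local : locally_in adj_tree iota_legal F h.
  move=> v.
  have : FF [set g | forall j, vact g (nbr v j) = h (nbr v j)].
    by apply: filter_forall => j; exact: hP.
  move=> /(filterI (hP v))/filter_ex[g /= [gv gj]].
  have [s sF gs] := plus_locally_in adj_tree iota_legal g v.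
  by exists s => // j; rewrite -gj gs gv.
pose i0 := iota set0.
have [g /= [gx gx']] := filter_ex (filterI (hP x) (hP (nbr x i0))).
have x_adj := adj_neighbor adj_tree iota_legal x i0.
have [p pE] := locally_in_plus h_local x_adj gx gx'.
by exists p; apply/plus_cvgP => z; rewrite pE; exact: hP.
Qed.

Section Escaping.
Variable x0 : V.
Hypothesis escaping : forall y, ~ FF [set g | vact g x0 = y].

Local Notation path_to g := (word nbr x0 (vact g x0)).

(** The vertices [vact g x0] converge to an end of the tree: the letters of
    [c] are the colors of the ray from [x0] to that end. *)
Lemma escaping_prefix : exists c : nat -> 'I_d, forall n,
  FF [set g | exists w, path_to g = mkseq c n ++ w].
Proof.
pose i0 := iota set0.
have [c cP] := choice (fun n =>
  ultra_finite (fun g : G => nth i0 (path_to g) n)).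
exists c => n.
have letters m : FF [set g | forall i : 'I_m, nth i0 (path_to g) i = c i].
  by apply: filter_forall => i; exact: cP.
have [short|long] :=
    in_ultra_setVsetC [set g | (size (path_to g) <= n)%N] FF_ultra.
  (* Words of bounded length take finitely many values. *)
  have [m mP] :=
    ultra_finite (fun g : G => inord (size (path_to g)) : 'I_n.+1).
  case: (@escaping (walk x0 (mkseq c m))).
  apply: filterS3 short mP (letters m) => g /= gn gm gl.
  rewrite -[LHS](walk_word nbr x0); congr walk.
  have gE : size (path_to g) = m by rewrite -gm inordK.
  apply: (@eq_from_nth _ i0); rewrite ?size_mkseq // gE => i im.
  by rewrite nth_mkseq // (gl (Ordinal im)).
apply: filterS2 long (letters n) => g /= /negP; rewrite -ltnNge => gn gl.
exists (drop n (path_to g)).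
rewrite -[LHS](cat_take_drop n); congr cat.
apply: (@eq_from_nth _ i0); rewrite ?size_mkseq size_take gn // => i im.
by rewrite nth_take // nth_mkseq // (gl (Ordinal im)).
Qed.

Variable c : nat -> 'I_d.
Hypothesis c_prefix : forall n,
  FF [set g | exists w, path_to g = mkseq c n ++ w].
Local Notation ray m := (walk x0 (mkseq c m)).

Lemma rayS m : ray m.+1 = nbr (ray m) (c m).
Proof. by rewrite mkseqS foldl_rcons. Qed.

Lemma ray_reduced n : reduced (mkseq c n).
Proof.
have [g [w gw]] := filter_ex (c_prefix n).
by have := word_reduced nbr x0 (vact g x0); rewrite gw => /cat_sorted2[].
Qed.

Lemma ray_turn n : c n != c n.+1.
Proof.
have := ray_reduced n.+2.
rewrite 2!mkseqS -cats1 -cats1 -catA => /cat_sorted2[_].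
by rewrite /= andbT.
Qed.

(** For a general vertex [y], moving to a neighbor costs one step along the
    ray. *)
Lemma ray_half_tree m y :
  FF [set g | half_tree nbr (ray m) (c m) (vact g y)].
Proof.
have [w <-] := nb_connected nbr x0 y.
elim/last_ind: w m => [|w j IH] m.
  apply: filterS (c_prefix m.+1) => g [w gw] /=.
  have := word_reduced nbr x0 (vact g x0).
  rewrite -{2}(walk_word nbr x0 (vact g x0)) gw.
  rewrite mkseqS -cats1 -catA => /cat_sorted2[_ rw].
  by exists w; rewrite // foldl_cat.
apply: filterS (IH m.+1) => g; rewrite /mkset foldl_rcons.
have [k ->] := act_nbr adj_tree iota_legal g (walk x0 w) j.
move=> /(half_tree_edge k); rewrite rayS => -[|[-> _ _]].
  by apply: half_tree_sub; exact: ray_turn.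
exact: half_tree_nb.
Qed.

(** The automorphism [u m] obtained by twisting along an edge of the ray fixes
    the half-tree towards the end and moves [x0]; the displacement of [x0]
    grows with the position of the edge. *)
Lemma ray_twists :
  (forall a b : 'I_d, b != a ->
    exists s : 'S_d, [/\ s \in F, s a = a & s b != b]) ->
  exists u : nat -> G, injective (fun m => vact (u m) x0) /\
  forall m y, FF [set g | vact (u m) (vact g y) = vact g y].
Proof.
move=> F_moves.
have twists m : exists u : G,
    size (word nbr x0 (vact u x0)) = (m.+1 + m.+1)%N /\
    forall y, FF [set g | vact u (vact g y) = vact g y].
  have [s [sF sc sk]] := F_moves (c m.+1) (c m) (ray_turn m).
  pose f := twist nbr s (ray m.+1) (c m.+1).
  have f_local : locally_in adj_tree iota_legal F f.
    move=> v; pose t : 'S_d :=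
      if `[< half_tree nbr (ray m.+1) (c m.+1) v >] then 1%g else s.
    exists t; first by rewrite /t; case: ifP.
    move=> j; rewrite /f (twist_local _ _ sc) /t; case: ifP => // _.
    by rewrite perm1.
  have ray_adj : adj (ray m.+1) (ray m.+2).
    by rewrite (rayS m.+1); exact: (adj_neighbor adj_tree iota_legal).
  have [||u uE] := edge_fixer_in_plus f_local ray_adj.
  - exact: twist_root.
  - by rewrite (rayS m.+1); apply: twist_id; exact: half_tree_nb.
  exists u; split.
    rewrite uE /f mkseqS twist_word //.
    - by rewrite size_cat size_map size_rev size_rcons size_mkseq.
    - exact: perm_inj.
    - by rewrite -mkseqS ray_reduced.
    - exact: ray_turn.
  move=> y; apply: filterS (ray_half_tree m.+1 y) => g gT.
  by rewrite /mkset uE /f twist_id.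
have [u uP] := choice twists; exists u; split=> [m n umn|m y]; last first.
  exact: (uP m).2.
have := (uP m).1; rewrite umn (uP n).1.
by lia.
Qed.

End Escaping.
End UltrafilterDynamics.

(** * Compactness of isotropy subgroups and the Howe-Moore property *)

Lemma Howe_Moore_compact_isotropy (R : realType) (G : topologicalGroupType)
    (H : hilbertType R) (pi : unitary_rep G H) (v : H) :
  vanishes_at_infinity (matrix_coef pi v v) -> v <> 0 ->
  compact (isotropy pi v).
Proof.
move=> vanish v0.
have v_gt0 : 0 < nrm v.
  by rewrite lt_neqAle nrm_ge0 andbT eq_sym; apply/eqP => /nrm0_eq0.
apply: subclosed_compact (vanish (nrm v ^+ 2) _) _.
- exact: isotropy_closed.
- by rewrite exprn_gt0.
- move=> g /= gv; rewrite /matrix_coef gv inner_norm normrX normr_id nrmE.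
  by rewrite -rmorphXn.
Qed.

(** A subset of [U(F)^+] that moves a vertex to infinitely many places is not
    compact. *)
Lemma not_compact_displacements d (V : choiceType) (adj : rel V)
    (iota : set V -> 'I_d) (F : {group 'S_d})
    (u : nat -> universal_group_plus adj iota F) x
    (A : set (universal_group_plus adj iota F)) :
  injective (fun m => vact (u m) x) -> (forall m, A (u m)) -> ~ compact A.
Proof.
move=> u_inj uA cptA.
have uoo : (u @ \oo) A by exists 0 => // m _; exact: uA.
have [p [_ clp]] := cptA _ _ uoo.
have near_p : nbhs p [set g | vact g x = vact p x].
  by have /plus_cvgP : nbhs p --> p by []; apply.
have frequently M : exists2 m, (M <= m)%N & vact (u m) x = vact p x.
  have [|_ [[m /= Mm <-] mx]] := clp (u @` [set m | (M <= m)%N]) _ _ near_p.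
    by exists M => // m /= Mm; exists m.
  by exists m.
have [m _ mx] := frequently 0; have [n mn nx] := frequently m.+1.
by move: mn; rewrite -mx in nx; rewrite (u_inj _ _ nx) ltnn.
Qed.

Theorem theorem1p4 (R : realType) (d : nat) (hd : (3 <= d)%N)
    (V : choiceType) (adj : rel V) (hT : regular_tree adj d)
    (iota : set V -> 'I_d) (hiota : legal_coloring adj iota)
    (F : {group 'S_d}) (hF : [primitive F, on [set: 'I_d]%SET | 'P])
    (hFnc : ~ (cyclic F /\ prime #|F|)) :
  Howe_Moore R (universal_group_plus adj iota F) <->
  forall (H : hilbertType R)
      (pi : unitary_rep (universal_group_plus adj iota F) H),
    infinite_dimensional H -> no_invariant_vectors pi ->
    forall v : H, v <> 0 -> compact (isotropy pi v).
Proof.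
split=> [HM H pi infH ninv v v0 | isoc H pi infH ninv v w eps eps0].
  exact: Howe_Moore_compact_isotropy (HM H pi infH ninv v v) v0.
set A := [set g | _]; rewrite compact_ultra => FF FF_ultra FFA.
pose G := universal_group_plus adj iota F.
have [[p FFp]|ncvg] := pselect (exists p : G, FF --> p).
  have clA : closed A by exact: superlevel_closed.
  exists p; split=> //; apply: clA => B Bp.
  exact/(filter_ex (filterI FFA (FFp B Bp))).
case: hT => adj_tree _; have [x0] := tree_nonempty adj_tree.
have escaping y : ~ FF [set g | vact g x0 = y].
  by move=> /(ultra_fixed_cvg adj_tree hiota).
have [c c_prefix] := escaping_prefix adj_tree hiota escaping.
have [|u [u_inj u_fix]] := ray_twists c_prefix.
  by move=> a b; exact: primitive_stab_moves.
have [x x_neq0 x_fix] := contracted_fixed_vector _ eps0 FFA.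
case: (not_compact_displacements u_inj _ (isoc H pi infH ninv x x_neq0)) => m.
apply: x_fix; apply/plus_cvgP => y.
rewrite vact1.
have sub : [set g | vact (u m) (vact g y) = vact g y] `<=`
    [set g | vact (g^-1 * u m * g)%g y = y].
  by move=> g ug; rewrite /mkset 2!vactM ug vactK.
exact: filterS sub (u_fix m y).
Qed.
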